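(* Let $k\ge 3$ be odd and let $G$ be an odd unicycle graph of girth $k$ whose Grover walk is periodic with odd period, whose unique cycle has vertices $u,u_1,\dots,u_{k-1}$ with $\deg u=4$ and $\deg u_i=2$ for $1\le i\le k-1$. Let $v_1,w_1$ be the two neighbours of $u$ off the cycle, let $t\ge1$, and suppose $v_1,\dots,v_t$ and $w_1,\dots,w_t$ are defined (as in the context) with $\deg v_1=\dots=\deg v_t=2$ and $\deg w_1=\dots=\deg w_t=2$. Then for every $1\le i\le t$: (1) $2^{2i}K_{2i}\in\mathbb{Z}$; (2) $2^{2(i-1)-1}L_{2(i-1)}(2)\in\mathbb{Z}$; (3) $2^{2(i-j)-1}L_{2(i-j)}(2,\dots,j+1)\in\mathbb{Z}$ for all $2\le j\le i-1$.
   Context: Graphs are simple, connected and finite. An odd unicycle graph is a non-bipartite graph with $|V|=|E|$, i.e. a connected graph with exactly one cycle, of odd length (its girth). Grover walk: with arcs $\mathcal{A}=\{(a,b),(b,a)\mid ab\in E\}$, $o((a,b))=a$, $t((a,b))=b$, $\overline{(a,b)}=(b,a)$, the time evolution $U$ on $\mathbb{C}^{\mathcal{A}}$ has $U_{e,f}=2/\deg t(f)$ if $t(f)=o(e)$, $e\neq\bar f$; $U_{e,f}=2/\deg t(f)-1$ if $e=\bar f$; $0$ otherwise; periodic means $U^m=I$ for some $m\ge1$, the least such $m$ being the period. Set $v_0=w_0=u$; recursively, if $v_{j-1}$ ($j\ge2$) is defined and has degree 2, $v_j$ is its neighbour other than $v_{j-2}$ (the unique vertex off the cycle side at distance $j$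 from $u$ through $v_1$); similarly for $w_j$. Put $g_j=v_{j-1}v_j$, $h_j=w_{j-1}w_j$. For an edge $e=ab$, $M(e)=\frac{1}{\deg a\deg b}$. Let $F$ be the set of edges of $G$ with no endpoint on the cycle. For $i\ge0$, $K_{2i}=\sum\prod_{l=1}^iM(e_l)$ over all $i$-matchings (sets of $i$ pairwise disjoint edges) $\{e_1,\dots,e_i\}\subseteq F$ (the empty matching contributing $1$, so $K_0=1$). For $r\ge2$, $K^g_{2i}(2,\dots,r)$ is the same sum restricted to matchings in $F\setminus\{g_2,\dots,g_r\}$, $K^h_{2i}(2,\dots,r)$ the same with $F\setminus\{h_2,\dots,h_r\}$, and $L_{2i}(2,\dots,r)=K^g_{2i}(2,\dots,r)+K^h_{2i}(2,\dots,r)$. *)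

(* Defs.v *)
From HB Require Import structures.
From mathcomp Require Import all_boot all_order all_algebra.
Set Implicit Arguments. Unset Strict Implicit. Unset Printing Implicit Defensive.
Import Order.TTheory GRing.Theory Num.Theory.
Local Open Scope ring_scope.

Section Graph.
Variables (T : finType) (e : rel T).

Definition simple_graph : Prop := symmetric e /\ irreflexive e.
Definition connected_graph : Prop := forall x y : T, connect e x y.
Definition bipartite : Prop :=
  exists f : T -> bool, forall x y, e x y -> f x != f y.

Definition deg (x : T) : nat := #|[pred y | e x y]|.

(* arcs (a,b) with ab an edge; #|arcs| = 2 |E| *)
Definition arcs : {set T * T} := [set a | e a.1 a.2].
Definition narcs : nat := #|arcs|.
Definition arc_of (i : 'I_narcs) : T * T := enum_val i.

(* Grover walk time evolution U, indexed by an enumeration of the arcs.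
   Entry (a, b): a = e, b = f; o(a) = a.1, t(a) = a.2, reverse of b = (b.2,b.1). *)
Definition grover : 'M[rat]_narcs :=
  \matrix_(i, j)
    let a := arc_of i in let b := arc_of j in
    if a == (b.2, b.1) then 2 / (deg b.2)%:R - 1
    else if b.2 == a.1 then 2 / (deg b.2)%:R else 0.

Definition mxpow (A : 'M[rat]_narcs) (m : nat) : 'M[rat]_narcs :=
  iter m (mulmx A) 1%:M.

Definition odd_period_grover : Prop :=
  exists m : nat, [/\ (0 < m)%N, odd m, mxpow grover m = 1%:M &
    forall m' : nat, (0 < m' < m)%N -> mxpow grover m' != 1%:M].

Definition is_edge (s : {set T}) : bool :=
  [exists x, exists y, e x y && (s == [set x; y])].

Definition Mw (s : {set T}) : rat := (\prod_(x in s) (deg x)%:R)^-1.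

Definition is_matching_in (cyc : {set T}) (X : {set {set T}})
    (i : nat) (M : {set {set T}}) : bool :=
  [&& #|M| == i,
      [forall s in M, [&& is_edge s, [disjoint s & cyc] & s \notin X]] &
      [forall s in M, forall s' in M, (s != s') ==> [disjoint s & s']]].

Definition Kgen (cyc : {set T}) (X : {set {set T}}) (i : nat) : rat :=
  \sum_(M : {set {set T}} | is_matching_in cyc X i M) \prod_(s in M) Mw s.

Definition pathedges (v : nat -> T) (r : nat) : {set {set T}} :=
  [set [set v l.-1; v (val l)] | l : 'I_r.+1 & (2 <= val l)%N].

(* K_{2i} = Kgen cyc set0 i ;  L_{2i}(2..r) = Lsum cyc v w i r *)
Definition Lsum (cyc : {set T}) (v w : nat -> T) (i r : nat) : rat :=
  Kgen cyc (pathedges v r) i + Kgen cyc (pathedges w r) i.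

End Graph.

Definition is_int (x : rat) : Prop := exists z : int, x = z%:~R.

(* Main.v *)
(** Let [T] be the transition matrix.  If [U ^ m = 1], every eigenvalue of [2 T]
    is [zeta + 1 / zeta] for a root of unity [zeta], so [det (I - 2 X T)] has
    integer coefficients.  In the permutation expansion of this determinant on a
    unicyclic graph, a permutation either only swaps adjacent vertices or rotates
    the whole cycle; the latter contribute [- X ^ k] times the minor [P_0] of the
    complement of the cycle.  All the other terms are even in [X] while [k] is
    odd, so [P_0] and the even part are integral separately; the coefficients of
    [P_0] are the numbers [(-4) ^ i K_{2i}], which is (1).  Expanding the even
    part around [u] gives
      [f_{k-1} P_0 - X ^ 2 f_{k-2} P_0 - f_{k-1} X ^ 2 (P_1(v) + P_1(w)) / 2]
    where [f_n] is the integral path polynomial, with constant term 1, and [P_n(v)]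
    is the minor of the vertices off the cycle other than [v_1, ..., v_n]; hence
    [(P_1(v) + P_1(w)) / 2] is integral, which is (2).  Finally
    [P_n(v) = P_{n+1}(v) - X ^ 2 P_{n+2}(v)] propagates integrality along the
    branches, which is (3). *)

Require Import Defs.
From HB Require Import structures.
From mathcomp Require Import all_boot all_order all_fingroup all_algebra all_field.
From mathcomp Require Import zify ring.
Import Order.TTheory GRing.Theory Num.Theory.
Local Open Scope ring_scope.
Set Implicit Arguments. Unset Strict Implicit. Unset Printing Implicit Defensive.

(** * Principal minors of [I - 2 X T] and matching polynomials *)

Section PrincipalMinors.
Variables (T : finType) (e : rel T) (a : T -> rat).
Hypotheses (e_sym : symmetric e) (e_irr : irreflexive e).
Implicit Types (V : {set T}).

(** For [a x = 2 / deg x] this is the entry of I - 2 X T, where T is the transition matrix of the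
    simple random walk. *)
Definition entry (x y : T) : {poly rat} :=
  if x == y then 1 else if e x y then - (a x *: 'X) else 0.

Definition pterm (s : {perm T}) : {poly rat} := (-1) ^+ s * \prod_x entry x (s x).

(** Points outside [V] are fixed and contribute a diagonal entry 1, so this is the principal minor
    on [V]. All minors are thus sums over the one type [{perm T}]. *)
Definition pminor V : {poly rat} := \sum_(s | perm_on V s) pterm s.

Definition along_edges (s : {perm T}) := forall z, s z = z \/ e z (s z).

(** The condition under which only matchings survive in the permutation expansion on [V]. *)
Definition swaps_only V :=
  forall s : {perm T}, perm_on V s -> along_edges s -> forall x, s (s x) = x.

Lemma swaps_onlyW (V W : {set T}) : W \subset V -> swaps_only V -> swaps_only W.
Proof.
move=> sWV sV s sW; apply: sV.
by apply: subset_trans sWV.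
Qed.

Lemma pterm_neq0 s : pterm s != 0 -> along_edges s.
Proof.
rewrite /pterm mulf_eq0 signr_eq0 /= => /prodf_neq0 nz z.
have := nz z isT; rewrite /entry.
case: (z =P s z) => [/esym|_]; first by left.
by case: ifP => [|_]; [right | rewrite eqxx].
Qed.

Lemma perm_onD1 V (s : {perm T}) x : (perm_on V s && (s x == x)) = perm_on (V :\ x) s.
Proof.
apply/andP/idP => [[sV /eqP sx]|sV].
  apply/subsetP => z sz; rewrite !inE (subsetP sV) // andbT.
  by apply: contraNneq sz => ->; rewrite sx.
split; last by rewrite (out_perm sV) // !inE eqxx.
by apply: subset_trans sV (subD1set _ _).
Qed.

Lemma pterm_tperm (s : {perm T}) x y : x != y -> e x y -> s x = x -> s y = y ->
  pterm (tperm x y * s)%g = - (a x * a y) *: 'X^2 * pterm s.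
Proof.
move=> nxy exy sx sy.
have nyx : y != x by rewrite eq_sym.
rewrite /pterm odd_permM odd_tperm nxy /= signrN.
rewrite (bigD1 x) // (bigD1 y) //= [in RHS](bigD1 x) // [in RHS](bigD1 y) //=.
rewrite !permM tpermL tpermR sx sy.
have -> : entry x y * (entry y x *
   \prod_(i | (i != x) && (i != y)) entry i ((tperm x y * s)%g i))
   = (a x * a y) *: 'X^2 * \prod_(i | (i != x) && (i != y)) entry i (s i).
  rewrite mulrA; congr (_ * _).
    rewrite /entry (negPf nxy) (negPf nyx) exy e_sym exy mulrNN -scalerAl -scalerAr.
    by rewrite scalerA.
  by apply: eq_bigr => i /andP[ix iy]; rewrite permM tpermD // eq_sym.
rewrite /entry !eqxx !mul1r scaleNr !mulNr.
by rewrite mulrCA.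
Qed.

(** A permutation with a nonzero term fixes [x], swaps it with a neighbour, or has [x] on a cycle of
    length at least 3. The three summands correspond to these cases. *)
Lemma pminor_vertex V x : x \in V ->
  pminor V = pminor (V :\ x)
    + \sum_(y in V | e x y) - (a x * a y) *: 'X^2 * pminor (V :\ x :\ y)
    + \sum_(s | perm_on V s && (s (s x) != x)) pterm s.
Proof.
move=> xV; rewrite {1}/pminor (bigID (fun s : {perm T} => s (s x) == x)) /=; congr (_ + _).
rewrite (partition_big (fun s : {perm T} => s x) predT) //= (bigD1 x) //=; congr (_ + _).
  apply: eq_bigl => s; rewrite -perm_onD1 -andbA; congr (_ && _).
  by apply/andP/eqP => [[_ /eqP //]|sx]; rewrite !sx eqxx.
rewrite (bigID (fun y => (y \in V) && e x y)) /= [X in _ + X]big1 ?addr0; last first.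
  move=> y /andP[nyx nV]; apply: big1 => s /andP[/andP[sV _] /eqP sxy].
  apply/eqP; apply: contraNT nV => /pterm_neq0 /(_ x); rewrite sxy.
  case=> [E|->]; first by rewrite E eqxx in nyx.
  by rewrite -sxy perm_closed // xV.
apply: eq_big => [y|y /and3P[nyx yV exy]].
  by case: eqVneq => [->|_] //=; rewrite e_irr andbF.
rewrite eq_sym in nyx.
(* Multiplication by the transposition matches the permutations swapping [x] and [y] with those
   fixing both. *)
rewrite (reindex_inj (mulgI (tperm x y))) /= mulr_sumr.
have tV : perm_on V (tperm x y).
  by apply: subset_trans (tperm_on x y) _; rewrite subUset !sub1set xV.
have tx (s : {perm T}) : (tperm x y * s)%g x = s y by rewrite permM tpermL.
apply: eq_big => [s|s].
  rewrite tx -!perm_onD1; case: (eqVneq (s y) y) => [E|_]; last by rewrite !andbF.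
  rewrite E permM tpermR !andbT; congr andb.
  apply/idP/idP => sV; last exact: perm_onM.
  by rewrite -[s](mulKVg (tperm x y)) tpermV; apply: perm_onM.
rewrite tx => /andP[/andP[_ sx] /eqP sy].
by rewrite pterm_tperm //; apply/eqP; rewrite sy permM tpermR in sx.
Qed.

Lemma pminor_vertex_swaps V x : x \in V -> swaps_only V ->
  pminor V = pminor (V :\ x)
    + \sum_(y in V | e x y) - (a x * a y) *: 'X^2 * pminor (V :\ x :\ y).
Proof.
move=> xV sV; rewrite (pminor_vertex xV) [X in _ + X]big1 ?addr0 //.
move=> s /andP[sVs nsx]; apply/eqP; apply: contraNT nsx => /pterm_neq0 sE.
by rewrite (sV s).
Qed.

Lemma pminor0 : pminor set0 = 1.
Proof.
rewrite /pminor (big_pred1 1%g) => [|s] /=; last first.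
  apply/idP/eqP => [s0|->]; last exact: perm_on1.
  by apply/permP => z; rewrite perm1 (out_perm s0) ?inE.
by rewrite /pterm odd_perm1 expr0 mul1r big1 // => x _; rewrite perm1 /entry eqxx.
Qed.

Definition matching_on V (M : {set {set T}}) : bool :=
  [forall s in M, is_edge e s && (s \subset V)] &&
  [forall s in M, forall s' in M, (s != s') ==> [disjoint s & s']].

Definition mweight (s : {set T}) : {poly rat} := - (\prod_(x in s) a x) *: 'X^2.

Definition matching_poly V : {poly rat} :=
  \sum_(M | matching_on V M) \prod_(s in M) mweight s.

Lemma is_edge2 x y : is_edge e [set x; y] = e x y.
Proof.
apply/existsP/idP => [[x' /existsP[y' /andP[exy /eqP E]]]|exy]; last first.
  by exists x; apply/existsP; exists y; rewrite exy eqxx.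
have nxy : x != y.
  apply: contraTneq exy => xy; move/setP: E; rewrite xy setUid => E.
  have := E x'; have := E y'; rewrite !inE !eqxx orbT /= => /eqP-> /eqP->.
  by rewrite e_irr.
have nxy' : x' != y' by apply: contraTneq exy => ->; rewrite e_irr.
move/setP: E => E; have := E x'; have := E y'.
rewrite !inE !eqxx orbT /= => /orP[]/eqP Ey /orP[]/eqP Ex; subst x' y' => //.
- by rewrite eqxx in nxy'.
- by rewrite e_sym.
- by rewrite eqxx in nxy'.
Qed.

Lemma matching_onP V (M : {set {set T}}) : reflect
  [/\ forall s, s \in M -> is_edge e s, forall s, s \in M -> s \subset V &
      forall s s' x, s \in M -> s' \in M -> x \in s -> x \in s' -> s = s']
  (matching_on V M).
Proof.
apply: (iffP andP) => [[/'forall_implyP M1 /'forall_implyP M2]|[M1 M2 M3]].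
  split=> [s sM|s sM|s s' x sM s'M xs xs'].
  - by have /andP[] := M1 s sM.
  - by have /andP[] := M1 s sM.
  - have /'forall_implyP/(_ s' s'M) := M2 s sM.
    case: eqVneq => //= _ /disjointFr/(_ xs).
    by rewrite xs'.
split; apply/'forall_implyP => s sM; first by rewrite M1 ?M2.
apply/'forall_implyP => s' s'M; apply/implyP => nss'.
rewrite -setI_eq0; apply/eqP/setP => x; rewrite !inE; apply/negP => /andP[xs xs'].
by rewrite (M3 s s' x) ?eqxx in nss'.
Qed.

(** The default value [x] stands for an unmatched vertex, so that the values of [partner] partition
    all matchings. *)
Definition partner (M : {set {set T}}) x :=
  odflt x [pick y | (y != x) && ([set x; y] \in M)].

Lemma matching_poly_vertex V x : x \in V ->
  matching_poly V = matching_poly (V :\ x)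
    + \sum_(y in V | e x y) - (a x * a y) *: 'X^2 * matching_poly (V :\ x :\ y).
Proof.
move=> xV; rewrite {1}/matching_poly (partition_big (partner^~ x) predT) //= (bigD1 x) //=.
have partnerP M y : matching_on V M -> y != x -> (partner M x == y) = ([set x; y] \in M).
  move=> /matching_onP[M1 M2 M3] nyx; rewrite /partner.
  case: pickP => [z /andP[nzx zM]|nM] /=; last first.
    by have := nM y; rewrite nyx /= => ->; rewrite eq_sym (negPf nyx).
  apply/eqP/idP => [<-//|yM].
  have /setP/(_ y) := M3 _ _ x zM yM (set21 _ _) (set21 _ _).
  by rewrite !inE eqxx orbT (negPf nyx) => /eqP.
congr (_ + _).
  apply: eq_bigl => M; apply/andP/idP => [[MV /eqP Mx]|MV].
    have /matching_onP[M1 M2 M3] := MV.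
    apply/matching_onP; split=> // s sM; apply/subsetP => z zs.
    rewrite !inE (subsetP (M2 s sM)) // andbT.
    apply: contraPneq Mx => zx; subst z.
    have /existsP[p /existsP[q /andP[epq /eqP spq]]] := M1 s sM.
    move: zs; rewrite spq !inE => xpq.
    have [y [nyx ys]] : exists y, y != x /\ s = [set x; y].
      case/orP: xpq => /eqP ?; subst x.
        by exists q; split=> //; apply: contraTneq epq => ->; rewrite e_irr.
      exists p; rewrite spq setUC; split=> //.
      by apply: contraTneq epq => ->; rewrite e_irr.
    have : partner M x == y by rewrite partnerP // -ys.
    by move=> /eqP ->; apply/eqP.
  have /matching_onP[M1 M2 M3] := MV.
  split.
    apply/matching_onP; split=> // s sM.
    by apply: subset_trans (M2 s sM) (subD1set _ _).
  rewrite /partner; case: pickP => //= y /andP[_ /M2/subsetP/(_ x)].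
  by rewrite !inE !eqxx /= => /(_ isT).
rewrite (bigID (fun y => (y \in V) && e x y)) /= [X in _ + X]big1 ?addr0; last first.
  move=> y /andP[nyx nV]; apply: big1 => M /andP[MV].
  rewrite partnerP // => sM; have /matching_onP[M1 M2 _] := MV.
  move: nV; rewrite -is_edge2 M1 // andbT => /negP[].
  by apply: (subsetP (M2 _ sM)); rewrite set22.
apply: eq_big => [y|y /and3P[nyx yV exy]].
  by case: eqVneq => [->|_] //=; rewrite e_irr andbF.
have wxy : mweight [set x; y] = - (a x * a y) *: 'X^2.
  by rewrite /mweight big_setU1 ?inE 1?eq_sym // big_set1.
pose s0 := [set x; y].
(* Removing the edge [s0] is a bijection from the matchings containing it to those avoiding both of
   its ends. *)
rewrite (reindex_onto (fun M => s0 |: M) (fun M => M :\ s0)) /=; last first.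
  by move=> M /andP[MV]; rewrite partnerP // => s0M; rewrite setD1K.
rewrite mulr_sumr.
have key M : [&& matching_on V (s0 |: M), partner (s0 |: M) x == y & (s0 |: M) :\ s0 == M]
   = matching_on (V :\ x :\ y) M.
  apply/idP/idP => [/and3P[MV _ /eqP E]|MV].
    have ns0 : s0 \notin M by rewrite -E !inE eqxx.
    have /matching_onP[M1 M2 M3] := MV.
    apply/matching_onP; split=> [s sM|s sM|s s' z sM s'M].
    - by apply: M1; rewrite !inE sM orbT.
    - have sM' : s \in s0 |: M by rewrite !inE sM orbT.
      apply/subsetP => z zs; rewrite !inE (subsetP (M2 _ sM')) // andbT -negb_or.
      apply: contra ns0 => zxy; have zs0 : z \in s0 by rewrite !inE orbC.
      by rewrite -(M3 s s0 z) // setU11.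
    - by apply: M3; rewrite !inE ?sM ?s'M orbT.
  have /matching_onP[M1 M2 M3] := MV.
  have ns s z : s \in M -> z \in s0 -> z \in s -> False.
    move=> sM + /(subsetP (M2 s sM)); rewrite !inE.
    by case/orP => ->; rewrite ?andbF.
  have ns0 : s0 \notin M.
    by apply/negP => /ns/(_ (set21 x y))/(_ (set21 x y)).
  have MV' : matching_on V (s0 |: M).
    apply/matching_onP; split=> [s|s|s s' z].
    - by rewrite !inE => /orP[/eqP->|/M1 //]; rewrite is_edge2.
    - rewrite !inE => /orP[/eqP->|/M2 sV]; first by rewrite subUset !sub1set xV.
      by apply: subset_trans sV _; rewrite setDDl subsetDl.
    - rewrite !in_setU1 => /orP[/eqP->|sM] /orP[/eqP->|s'M] //.
      + by move=> zs0 zs; have := ns _ _ s'M zs0 zs.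
      + by move=> zs zs0; have := ns _ _ sM zs0 zs.
      + exact: M3.
  by rewrite MV' partnerP // setU11 setU1K /=.
apply: eq_big => [M|M]; first by rewrite -andbA key.
rewrite -andbA key => MV; rewrite big_setU1 ?wxy //=.
have /matching_onP[_ M2 _] := MV.
by apply/negP => /M2/subsetP/(_ x (set21 x y)); rewrite !inE eqxx andbF.
Qed.

Lemma matching_poly0 : matching_poly set0 = 1.
Proof.
rewrite /matching_poly (big_pred1 set0) ?big_set0 // => M /=.
apply/matching_onP/eqP => [[M1 M2 _]|->]; last by split=> s; rewrite inE.
apply/setP => s; rewrite inE; apply/negP => sM.
have := M1 s sM; have := M2 s sM; rewrite subset0 => /eqP->.
by case/existsP => p /existsP[q /andP[_ /eqP/setP/(_ p)]]; rewrite !inE eqxx.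
Qed.

(** Both sides obey the same recursion under deletion of a vertex and agree on the empty set. *)
Lemma pminor_matching_poly V : swaps_only V -> pminor V = matching_poly V.
Proof.
have [n] := ubnP #|V|; elim: n V => // n IHn V leV sV.
have [->|[x xV]] := set_0Vmem V; first by rewrite pminor0 matching_poly0.
rewrite (pminor_vertex_swaps xV sV) (matching_poly_vertex xV).
have leVx : (#|V :\ x| < n)%N by rewrite (cardsD1 x V) xV in leV.
rewrite IHn //; last exact: swaps_onlyW (subD1set _ _) sV.
congr (_ + _); apply: eq_bigr => y _; rewrite IHn //.
  exact: leq_ltn_trans (subset_leq_card (subD1set _ _)) leVx.
by apply: swaps_onlyW sV; rewrite setDDl subsetDl.
Qed.

Lemma coef_matching_poly V j : (matching_poly V)`_j =
  if odd j then 0 else (-1) ^+ j./2 *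
    \sum_(M | matching_on V M && (#|M| == j./2)) \prod_(s in M) \prod_(x in s) a x.
Proof.
have prodE (M : {set {set T}}) : \prod_(s in M) mweight s =
    ((-1) ^+ #|M| * \prod_(s in M) \prod_(x in s) a x) *: 'X^(2 * #|M|).
  by rewrite /mweight scaler_prod prodrN prodr_const -exprM.
rewrite coef_sum; case: ifP => oj.
  apply: big1 => M _; rewrite prodE coefZ coefXn.
  case: eqP => [jE|_]; last by rewrite mulr0.
  by rewrite jE mul2n odd_double in oj.
rewrite mulr_sumr [RHS]big_mkcondr; apply: eq_bigr => M _.
rewrite prodE coefZ coefXn mul2n.
have -> : (j == #|M|.*2) = (#|M| == j./2).
  by rewrite -{1}(even_halfK (negbT oj)) eq_sym (inj_eq double_inj).
by case: eqP => [->|_]; rewrite ?mulr1 ?mulr0.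
Qed.

End PrincipalMinors.

(** * Permutations along the edges of a functional graph *)

Section FunctionalGraph.
Variables (T : finType) (e : rel T) (a : T -> rat).
Hypotheses (e_sym : symmetric e) (e_irr : irreflexive e).
Variables (C : {set T}) (rho : T -> T) (d : T -> nat).
Hypothesis rho_closed : forall x, x \in C -> rho x \in C.
Hypothesis rho_descends : forall x, x \notin C -> (d (rho x) < d x)%N.
Hypothesis rho_edge : forall x y, e x y -> y = rho x \/ x = rho y.
Hypothesis rho_transitive :
  forall x z, x \in C -> z \in C -> exists n, z = iter n rho x.

Lemma iter_rho_closed n x : x \in C -> iter n rho x \in C.
Proof. by move=> xC; elim: n => //= n; apply: rho_closed. Qed.

Lemma iter_rho_reaches n x : (d x <= n)%N -> iter n rho x \in C.
Proof.
elim: n x => [|n IHn] x le_n; rewrite ?iterSr; have [xC|nC] := boolP (x \in C) => //.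
- by have := leq_trans (rho_descends nC) le_n.
- by rewrite iter_rho_closed ?rho_closed.
- by apply: IHn; rewrite -ltnS; apply: leq_trans (rho_descends nC) le_n.
Qed.

(* A step [y = rho (s y)] against [rho] cannot be followed by a step along
   [rho], so it propagates along the whole orbit of [s]. *)
Lemma perm_against_rho (s : {perm T}) x : along_edges e s -> s (s x) != x ->
  x = rho (s x) -> forall z, z \in C -> s (rho z) = z.
Proof.
move=> sE nsx xs.
have orb n : s (s (iter n s x)) != iter n s x /\ iter n s x = rho (s (iter n s x)).
  elim: n => //= n [IH1 IH2]; set y := iter n s x in IH1 IH2 *; split.
    by apply: contra_neq IH1; apply: perm_inj.
  case: (sE (s y)) => [E|/rho_edge[E|//]]; last by rewrite E -IH2 eqxx in IH1.
  by move/perm_inj: (E) => E'; rewrite E' E' eqxx in IH1.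
have back i j : iter i rho (iter (i + j) s x) = iter j s x.
  by elim: i => // i IH; rewrite iterSr addSn iterS -(proj2 (orb _)).
have per m : iter (#[s]%g * m) s x = x.
  by rewrite -permX expgM expg_order expg1n perm1.
have o_gt0 : (0 < #[s]%g)%N := order_gt0 s.
have powE i m : (i <= #[s]%g * m)%N -> iter i rho x = iter (#[s]%g * m - i) s x.
  by move=> le_i; rewrite -(back i) subnKC // per.
(* Stepping back along enough full turns of the orbit of [s] returns to [x], and that many steps of
   [rho] end on the cycle. *)
have xC : x \in C.
  have -> : x = iter (#[s]%g * d x) rho x by rewrite (powE _ (d x)) // subnn.
  by apply: iter_rho_reaches; rewrite leq_pmull.
move=> z zC; have [n ->] := rho_transitive xC zC.
rewrite -iterS (powE n.+1 n.+1) ?leq_pmull // -iterS.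
have le_n : (n < #[s]%g * n.+1)%N by rewrite leq_pmull.
by rewrite (powE n n.+1) ?(ltnW le_n) // -subSn.
Qed.

(** If [s] moves [x] along [rho], then its inverse moves [s x] against [rho], so [perm_against_rho]
    applies to [s] or to its inverse. *)
Lemma perm_orients_cycle (s : {perm T}) x : along_edges e s -> s (s x) != x ->
  (forall z, z \in C -> s (rho z) = z) \/ (forall z, z \in C -> s z = rho z).
Proof.
move=> sE nsx; case: (sE x) => [sx|/rho_edge[sx|sx]].
- by rewrite !sx eqxx in nsx.
- right=> z zC.
  have sVE : along_edges e s^-1%g.
    move=> y; case: (sE (s^-1%g y)); rewrite permKV; first by left.
    by rewrite e_sym; right.
  have nsVx : s^-1%g (s^-1%g (s x)) != s x.
    by rewrite permK; apply: contra_neq nsx => <-; rewrite permKV.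
  have sVx : s x = rho (s^-1%g (s x)) by rewrite permK.
  by rewrite -{1}(perm_against_rho sVE nsVx sVx zC) permKV.
- by left; apply: perm_against_rho nsx sx.
Qed.

Hypothesis rho2_neq : forall x, x \in C -> rho (rho x) != x.

Lemma rho_neq x : x \in C -> rho x != x.
Proof. by move=> xC; apply: contra_neq (rho2_neq xC) => E; rewrite !E. Qed.

(** A permutation that is not an involution would turn the whole cycle; as it fixes [u], this would
    force [rho u = u]. *)
Lemma swaps_only_off_cycle (V : {set T}) u : u \in C -> u \notin V -> swaps_only e V.
Proof.
move=> uC uV s sV sE x; apply/eqP/negPn/negP => nsx.
have su : s u = u by rewrite (out_perm sV).
have /eqP := rho_neq uC; apply.
case: (perm_orients_cycle sE nsx) => /(_ u uC) E; last by rewrite -E.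
by apply: (@perm_inj _ s); rewrite E.
Qed.

(** The permutations agreeing with [r] on [C] are the products [t * r] with [t] supported off [C],
    and an even [r] leaves the sign unchanged. *)
Lemma sum_pterm_extending (r : {perm T}) : perm_on C r -> ~~ odd_perm r ->
  \sum_(s : {perm T} | [forall x in C, s x == r x]) pterm e a s
    = \prod_(x in C) entry e a x (r x) * pminor e a (~: C).
Proof.
move=> rC even_r; rewrite (reindex_inj (mulIg r)) mulr_sumr.
apply: eq_big => [t|t tC].
  apply/forall_inP/subsetP => [tC x|tC x xC].
    rewrite !inE; apply: contra => xC.
    by apply/eqP/(@perm_inj _ r); rewrite -permM; apply/eqP/tC.
  rewrite permM; suff -> : t x = x by [].
  by apply/eqP; apply: contraLR xC => /tC; rewrite inE.
have tid x : x \in C -> t x = x.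
  by move=> xC; apply/(@perm_inj _ r); rewrite -permM; apply/eqP/(forall_inP tC).
have tout x : x \notin C -> t x \notin C.
  by apply: contra => txC; rewrite -(perm_inj (tid _ txC)).
rewrite /pterm odd_permM (negPf even_r) addbF mulrCA; congr (_ * _).
rewrite (bigID (mem C)) [X in _ = _ * X](bigID (mem C)) /=.
rewrite [X in _ = _ * (X * _)]big1 ?mul1r => [|x xC]; last by rewrite tid /entry ?eqxx.
congr (_ * _); apply: eq_bigr => x xC; rewrite permM; first by rewrite tid.
by rewrite (out_perm rC) // tout.
Qed.

(** The remaining sum of [pminor_vertex] runs over the extensions of [r] and of its inverse. The two
    directions have equal products on the cycle, whence the factor 2. *)
Lemma pminor_cycle (r : {perm T}) u : u \in C -> perm_on C r -> ~~ odd_perm r ->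
    (forall x, x \in C -> r x = rho x) -> (forall x, x \in C -> e x (rho x)) ->
  pminor e a setT = pminor e a (setT :\ u)
    + \sum_(y | e u y) - (a u * a y) *: 'X^2 * pminor e a (setT :\ u :\ y)
    + ((-1) ^+ #|C| * \prod_(x in C) a x) *: 'X^#|C| *+ 2 * pminor e a (~: C).
Proof.
move=> uC rC even_r rE eC.
have prodC (r' : {perm T}) : (forall x, x \in C -> r' x != x /\ e x (r' x)) ->
    \prod_(x in C) entry e a x (r' x) = ((-1) ^+ #|C| * \prod_(x in C) a x) *: 'X^#|C|.
  move=> r'E; rewrite (eq_bigr (fun x => (- a x) *: 'X)) => [|x xC].
    by rewrite scaler_prodr prodrN.
  by have [nx ex] := r'E x xC; rewrite /entry eq_sym (negPf nx) ex scaleNr.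
rewrite (pminor_vertex _ e_sym e_irr (in_setT u)); congr (_ + _ + _).
  by apply: eq_bigl => y; rewrite inE.
have r2 x : x \in C -> r (r x) != x.
  by move=> xC; rewrite !rE ?rho_closed ?rho2_neq.
have rV x : x \in C -> (r^-1)%g x \in C by rewrite (perm_closed _ (perm_onV rC)).
rewrite mulrnAl mulr2n -{1}(prodC r) => [|x xC]; last by rewrite rE ?rho_neq ?eC.
rewrite -(prodC (r^-1)%g) => [|x xC]; last first.
  have rVE : rho (r^-1%g x) = x by rewrite -rE ?rV // permKV.
  by rewrite -{2 3}rVE e_sym eC ?rV // eq_sym rho_neq ?rV.
rewrite -sum_pterm_extending // -sum_pterm_extending ?odd_permV ?perm_onV //.
rewrite (bigID (fun s : {perm T} => [forall x in C, s x == r x])) /=; congr (_ + _).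
  apply: eq_bigl => s; apply/andP/idP => [[]//|sr]; split=> //.
  have E x : x \in C -> s x = r x by move=> xC; apply/eqP/(forall_inP sr).
  by rewrite !E ?rE ?rho_closed ?rho2_neq // andbT; apply/subsetP.
(* The two index conditions are compared only for permutations along edges; all other terms
   vanish. *)
rewrite big_mkcond [in RHS]big_mkcond /=; apply: eq_bigr => s _.
have [->|/pterm_neq0 sE] := eqVneq (pterm e a s) 0; first by rewrite !if_same.
have -> // : [&& perm_on setT s && (s (s u) != u) & ~~ [forall x in C, s x == r x]]
    = [forall x in C, s x == (r^-1)%g x].
apply/idP/forall_inP => [/andP[/andP[_ nsu] nsr] x xC|sr].
  case: (perm_orients_cycle sE nsu) => E.
    by rewrite -{1}[x](permKV r) rE ?rV // E ?rV.
  by case/negP: nsr; apply/forall_inP => z zC; rewrite E ?rE.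
have E x : x \in C -> s x = (r^-1)%g x by move=> xC; apply/eqP/sr.
have nr : (r^-1)%g u != r u.
  by apply: contra_neq (r2 u uC) => <-; rewrite permKV.
apply/andP; split.
  apply/andP; split; first exact/subsetP.
  rewrite !E ?rV //; apply: contra_neq (r2 u uC) => u2.
  by rewrite -{1}u2 !permKV.
by apply/negP => /forall_inP/(_ u uC); rewrite E // (negPf nr).
Qed.

End FunctionalGraph.

(** * Unicyclic graphs are functional graphs *)

Lemma odd_permXn (T : finType) (s : {perm T}) n :
  odd_perm (s ^+ n)%g = odd n && odd_perm s.
Proof.
elim: n => [|n IHn]; first by rewrite expg0 odd_perm1.
by rewrite expgS odd_permM IHn /=; case: odd_perm; case: odd.
Qed.

Lemma iter_ordS k n (i : 'I_k) : val (iter n (@ordS k) i) = ((val i + n) %% k)%N.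
Proof.
elim: n => [|n IHn] /=; first by rewrite addn0 modn_small.
by rewrite IHn addnS -addn1 modnDml addn1.
Qed.

Lemma ordS2_neq k (i : 'I_k) : (3 <= k)%N -> ordS (ordS i) != i.
Proof.
move=> k_ge3; rewrite -val_eqE (iter_ordS 2 i) /=.
have := ltn_ord i; case: (ltnP (i + 2) k) => [lt_i2|le_i2] lt_i.
  by rewrite modn_small //; lia.
by rewrite -(subnK le_i2) modnDr modn_small; lia.
Qed.

Section Unicyclic.
Variables (T : finType) (e : rel T) (k : nat) (c : 'I_k -> T).
Hypotheses (e_sym : symmetric e) (e_irr : irreflexive e).
Hypothesis e_conn : connected_graph e.
Hypothesis arcs_card : #|arcs e| = (2 * #|T|)%N.
Hypotheses (k_ge3 : (3 <= k)%N) (c_inj : injective c).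
Hypothesis c_edge : forall i, e (c i) (c (ordS i)).

(** Take the least length of a walk from [u]; the last but one vertex of a shortest walk is
    closer. *)
Lemma exists_distance (u : T) : exists d : T -> nat,
  forall x, x != u -> exists2 y, e x y & (d y < d x)%N.
Proof.
pose reach x n := [exists p : n.-tuple T, path e u p && (last u p == x)].
have ex x : exists n, reach x n.
  have /connectP[p ep ->] := e_conn u x.
  by exists (size p); apply/existsP; exists (in_tuple p); rewrite ep eqxx.
exists (fun x => ex_minn (ex x)) => x nxu.
case: ex_minnP => n /existsP[[p /= /eqP sp] /andP[ep /eqP lp]] _.
case/lastP: p => [|p z] in sp ep lp *; first by rewrite -lp eqxx in nxu.
move: ep lp; rewrite rcons_path last_rcons => /andP[ep ez] zx; subst z.
exists (last u p); first by rewrite e_sym.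
case: ex_minnP => m _ /(_ (size p)) le_m.
rewrite -sp size_rcons ltnS le_m //.
by apply/existsP; exists (in_tuple p); rewrite ep eqxx.
Qed.

Let C := [set c i | i : 'I_k].

(* A connected graph with as many edges as vertices is the graph of a function:
   follow the cycle, and otherwise step towards it.  These [#|T|] edges are
   distinct, so there are no others. *)
Lemma unicyclic_functional : exists (rho : T -> T) (d : T -> nat),
  [/\ forall i, rho (c i) = c (ordS i),
      forall x, x \notin C -> (d (rho x) < d x)%N,
      forall x, e x (rho x) &
      forall x y, e x y -> y = rho x \/ x = rho y].
Proof.
pose i0 : 'I_k := Ordinal (leq_trans (isT : (0 < 3)%N) k_ge3).
have [d dP] := exists_distance (c i0).
pose P x y := [/\ e x y, forall i, x = c i -> y = c (ordS i)
      & x \notin C -> (d y < d x)%N].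
have [rho rhoP] : exists rho, forall x, P x (rho x).
  apply: (@fin_all_exists _ _ P) => x; have [/imsetP[i _ ->]|nC] := boolP (x \in C).
    by exists (c (ordS i)); split=> // [j /c_inj->//|]; rewrite imset_f.
  have [|y exy dy] := dP x; first by apply: contraNneq nC => ->; rewrite imset_f.
  by exists y; split=> // i xi; rewrite xi imset_f in nC.
exists rho, d; have rc i : rho (c i) = c (ordS i) by have [_ /(_ i erefl)] := rhoP (c i).
have rC x : x \in C -> rho x \in C by move=> /imsetP[i _ ->]; rewrite rc imset_f.
split=> // [x nC|x|]; [by have [_ _ ->] := rhoP x | by have [] := rhoP x |].
pose A1 := [set (x, rho x) | x : T]; pose A2 := [set (rho x, x) | x : T].
(* No edge arises from both of its ends: the cycle has length at least 3, and off it [d]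
   decreases. *)
have rho2 x : rho (rho x) != x.
  have [/imsetP[i _ ->]|nC] := boolP (x \in C).
    by rewrite !rc (inj_eq c_inj) ordS2_neq.
  apply: contraNneq nC => x2; have [xC|nC] := boolP (rho x \in C).
    by rewrite -x2 rC.
  have [_ _ /(_ nC)] := rhoP (rho x); rewrite x2 => lt1.
  apply: contraLR lt1 => nC'; have [_ _ /(_ nC')] := rhoP x.
  by rewrite -leqNgt => /ltnW.
have A12 : [disjoint A1 & A2].
  rewrite -setI_eq0; apply/eqP/setP => f; rewrite !inE; apply/negP.
  move=> /andP[/imsetP[x _ ->] /imsetP[y _ [xy yx]]].
  by have /eqP := rho2 y; rewrite -xy.
have sub : A1 :|: A2 \subset arcs e.
  apply/subsetP => f; rewrite !inE => /orP[]/imsetP[x _ ->] /=.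
    by have [] := rhoP x.
  by rewrite e_sym; have [] := rhoP x.
have : A1 :|: A2 == arcs e.
  rewrite eqEcard sub arcs_card cardsU (disjoint_setI0 A12) cards0 subn0.
  rewrite !card_imset ?cardsT ?mul2n ?addnn ?leqnn //; first by move=> x y [].
  by move=> x y [].
move=> /eqP E x y exy; have : (x, y) \in arcs e by rewrite inE.
by rewrite -E !inE => /orP[]/imsetP[z _ [-> ->]]; [left | right].
Qed.

Variable rho : T -> T.
Hypothesis rho_c : forall i, rho (c i) = c (ordS i).

Lemma rho_cycle_closed x : x \in C -> rho x \in C.
Proof. by move=> /imsetP[i _ ->]; rewrite rho_c imset_f. Qed.

Lemma iter_rho_c n i : iter n rho (c i) = c (iter n (@ordS k) i).
Proof. by elim: n => //= n ->; rewrite rho_c. Qed.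

Lemma rho_cycle_transitive x z : x \in C -> z \in C -> exists n, z = iter n rho x.
Proof.
move=> /imsetP[i _ ->] /imsetP[j _ ->]; exists (k - i + j)%N.
rewrite iter_rho_c; congr c; apply: val_inj; rewrite iter_ordS addnA.
by rewrite subnKC ?(ltnW (ltn_ord i)) // modnDl modn_small.
Qed.

Lemma rho_cycle2_neq x : x \in C -> rho (rho x) != x.
Proof. by move=> /imsetP[i _ ->]; rewrite !rho_c (inj_eq c_inj) ordS2_neq. Qed.

(** The rotation satisfies [r ^+ k = 1] with [k] odd, hence is even. *)
Lemma exists_rotation : odd k -> exists r : {perm T},
  [/\ perm_on C r, ~~ odd_perm r & forall x, x \in C -> r x = rho x].
Proof.
move=> odd_k; pose f x := if x \in C then rho x else x.
have fC x : (f x \in C) = (x \in C).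
  by rewrite /f; case: ifP => // xC; rewrite rho_cycle_closed.
have f_inj : injective f.
  move=> x y E; have := fC x; rewrite E fC /f => Exy; move: E; rewrite /f Exy.
  case: ifP => // xC; rewrite xC in Exy.
  have /imsetP[i _ ->] := xC; have /imsetP[j _ ->] := Exy.
  rewrite !rho_c => /c_inj E; congr c; apply: (can_inj (@ordSK k)) E.
exists (perm f_inj); split.
- by apply/subsetP => x; rewrite inE permE /f; case: ifP => //; rewrite eqxx.
- have : (perm f_inj ^+ k)%g = 1%g.
    apply/permP => x; rewrite permX perm1 (eq_iter (permE f_inj)).
    have [xC|nC] := boolP (x \in C); last first.
      by apply: iter_fix; rewrite /f (negPf nC).
    have /imsetP[i _ xi] := xC.
    have fE n : iter n f x = iter n rho x.
      elim: n => //= n ->; rewrite /f ifT //.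
      by elim: n => //= n; apply: rho_cycle_closed.
    rewrite fE xi iter_rho_c; congr c; apply: val_inj.
    by rewrite iter_ordS modnDr modn_small ?(ltn_ord i).
  by move/(congr1 (@odd_perm T)); rewrite odd_permXn odd_k odd_perm1 /= => ->.
- by move=> x xC; rewrite permE /f xC.
Qed.

End Unicyclic.

(** * Periodicity makes [det (I - 2 X T)] integral *)

(** A decomposition of [s] into transpositions is carried over by [g]. This is needed to pass from
    permutations of vertices to those of ordinals, over which [\det] is defined. *)
Lemma odd_perm_conjugate (T T' : finType) (g : T -> T') (s : {perm T}) (s' : {perm T'}) :
  bijective g -> (forall x, s' (g x) = g (s x)) -> odd_perm s' = odd_perm s.
Proof.
move=> [h gK hK] gs; have g_inj := can_inj gK.
have [ts sE dts] := prod_tpermP s.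
pose ts' := [seq (g t.1, g t.2) | t <- ts].
have prodE x : (\prod_(t <- ts') tperm t.1 t.2)%g (g x)
             = g ((\prod_(t <- ts) tperm t.1 t.2)%g x).
  rewrite big_map; elim: (ts) x => [|t r IHr] x; first by rewrite !big_nil !perm1.
  by rewrite !big_cons !permM /= -inj_tperm // IHr.
have -> : s' = (\prod_(t <- ts') tperm t.1 t.2)%g.
  by apply/permP => x; rewrite -[x]hK prodE -sE gs.
rewrite sE !odd_perm_prod ?size_map // all_map.
by apply: sub_all dts => t /=; rewrite /dpair /= (inj_eq g_inj).
Qed.

Lemma sum_pterm_det (T : finType) (F : T -> T -> {poly rat}) :
  \sum_(s : {perm T}) (-1) ^+ s * \prod_x F x (s x)
    = \det (\matrix_(i, j < #|T|) F (enum_val i) (enum_val j)).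
Proof.
pose tr (s : {perm T}) := fun i : 'I_#|T| => enum_rank (s (enum_val i)).
have tr_inj s : injective (tr s).
  by move=> i j /enum_rank_inj/perm_inj/enum_val_inj.
pose tr' (s : 'S_#|T|) := fun x => enum_val (s (enum_rank x)).
have tr'_inj s : injective (tr' s).
  by move=> i j /enum_val_inj/perm_inj/enum_rank_inj.
rewrite /determinant (reindex (fun s => perm (@tr_inj s))) /=; last first.
  exists (fun s => perm (@tr'_inj s)) => s _; apply/permP => x.
    by rewrite !permE /tr' !permE /tr !enum_rankK.
  by rewrite !permE /tr !permE /tr' !enum_valK.
apply: eq_bigr => s _; congr (_ * _).
  congr (_ ^+ nat_of_bool _); apply/esym.
  apply: (@odd_perm_conjugate _ _ enum_rank) => [|x]; first exact: enum_rank_bij.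
  by rewrite permE /tr enum_rankK.
rewrite (reindex (@enum_val T predT)) /=; last exact/onW_bij/enum_val_bij.
by apply: eq_bigr => i _; rewrite mxE permE /tr enum_rankK.
Qed.

Section Spectrum.
Variables (T : finType) (e : rel T).
Hypotheses (e_sym : symmetric e) (e_irr : irreflexive e) (deg_gt0 : forall x, (0 < deg e x)%N).

Lemma Aint_inv_root (z zi : algC) n : (0 < n)%N -> z ^+ n = 1 -> z * zi = 1 ->
  z + zi \in Aint.
Proof.
move=> n_gt0 zn zzi.
have zin : zi ^+ n = 1 by rewrite -[LHS]mul1r -zn -exprMn zzi expr1n.
by rewrite rpredD // (Aint_unity_root n_gt0) //; apply/unity_rootP.
Qed.

(** A left eigenvector [w] of 2 T for [lam = z + zi] with [z * zi = 1] lifts to a row vector on arcs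
    on which U acts as [z]. If this lift is nonzero, then [z ^+ m = 1]; if it vanishes, then
    [zi ^+ 2 = 1]. Either way [lam] is a sum of two roots of unity. *)
Lemma Aint_grover_eigenvalue m (lam : algC) (w : T -> algC) p :
    (0 < m)%N -> mxpow (grover e) m = 1%:M -> w p != 0 ->
    (forall y, lam * w y = \sum_(x | e x y) w x * ratr (2 / (deg e x)%:R)) ->
  lam \in Aint.
Proof.
move=> m_gt0 Um wp0 wE.
(* [z] and [zi] will be the roots of Z^2 - [lam] Z + 1. *)
pose sq : algC := sqrtC (lam ^+ 2 - 4).
have sqE : sq ^+ 2 = lam ^+ 2 - 4 by rewrite sqrtCK.
pose z : algC := (lam + sq) / 2; pose zi : algC := (lam - sq) / 2.
have lamE : lam = z + zi by rewrite /z /zi; field.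
have zzi : z * zi = 1.
  have -> : z * zi = (lam ^+ 2 - sq ^+ 2) / 4 by rewrite /z /zi; field.
  by rewrite sqE; field.
pose dg x : algC := (deg e x)%:R; pose al x : algC := w x / dg x.
have dg0 x : dg x != 0 by rewrite pnatr_eq0 -lt0n.
have alE y : lam * (dg y * al y) = 2 * \sum_(x | e x y) al x.
  have -> : dg y * al y = w y by rewrite mulrC divfK.
  rewrite wE mulr_sumr; apply: eq_bigr => x _.
  by rewrite fmorph_div /= !ratr_nat mulrCA.
pose psi (f : T * T) : algC := al f.2 - zi * al f.1.
pose phi : 'rV[algC]_(narcs e) := \row_i psi (arc_of i).
have sum_out q : \sum_(f in arcs e | q == f.1) psi f = (z - zi) * dg q * al q / 2.
  rewrite (reindex_onto (fun y => (q, y)) snd) /= => [|[x y] /andP[_ /= /eqP->]] //.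
  rewrite (eq_bigl (e q)) => [|y]; last by rewrite inE /= !eqxx !andbT.
  rewrite sumrB.
  have -> : \sum_(y | e q y) zi * al q = dg q * (zi * al q).
    by rewrite /dg mulr_natl /deg -sumr_const.
  have -> : \sum_(i | e q i) al i = lam * (dg q * al q) / 2.
    rewrite alE mulrAC mulfV ?pnatr_eq0 // mul1r.
    by apply: eq_bigl => x; rewrite e_sym.
  by rewrite lamE; field.
have phiU : phi *m map_mx ratr (grover e) = z *: phi.
  apply/rowP => j; rewrite !mxE.
  have : arc_of j \in arcs e := enum_valP j.
  case jE: (arc_of j) => [a b]; rewrite inE /= => eab.
  (* The column of U at the arc (a, b) is 2 / deg b on all arcs leaving b, minus 1 at the reverse
     arc. *)
  transitivity (\sum_(f in arcs e) psi f *
     ((if b == f.1 then 2 / dg b else 0) - (f == (b, a))%:R)).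
    rewrite (big_enum_val (A := mem (arcs e))); apply: eq_bigr => i _.
    rewrite !mxE /arc_of /=; set f := enum_val i.
    have -> : enum_val j = (a, b) := jE.
    case: eqP => [->|_] /=; rewrite ?eqxx.
      by rewrite rmorphB rmorph1 fmorph_div /= !ratr_nat.
    by rewrite subr0; case: eqP; rewrite ?rmorph0 // fmorph_div /= !ratr_nat.
  under eq_bigr do rewrite mulrBr.
  rewrite sumrB [X in _ - X](bigD1 (b, a)) /= ?inE ?[e b a]e_sym //=.
  rewrite [X in _ - (_ + X)]big1 ?addr0 => [|f /andP[_ /negPf->]]; last by rewrite mulr0.
  rewrite eqxx mulr1.
  have -> : \sum_(f in arcs e) psi f * (if b == f.1 then 2 / dg b else 0)
          = (z - zi) * dg b * al b / 2 * (2 / dg b).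
    rewrite -sum_out mulr_suml big_mkcondr /=; apply: eq_bigr => f _.
    by case: eqP => _; rewrite ?mulr0.
  rewrite /psi /=.
  have := dg0 b; set B := al b; set A := al a; move=> dgb0.
  have -> : (z - zi) * dg b * B / 2 * (2 / dg b) = (z - zi) * B by field.
  have zziA : z * (zi * A) = A by rewrite [LHS]mulrA zzi mul1r.
  by rewrite [RHS]mulrBr zziA; ring.
have phiUn n : phi *m map_mx ratr (mxpow (grover e) n) = z ^+ n *: phi.
  elim: n => [|n IHn]; first by rewrite map_mx1 mulmx1 expr0 scale1r.
  by rewrite /= map_mxM mulmxA phiU -scalemxAl IHn scalerA exprS.
have := phiUn m; rewrite Um map_mx1 mulmx1 lamE.
(* When the lift vanishes, crossing an edge multiplies [al] by [zi]; crossing it there and back at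
   [p] gives [zi ^+ 2 = 1]. *)
have [phi0 _|phi_n0 phiE] := eqVneq phi 0; last first.
  apply: (Aint_inv_root m_gt0) zzi; apply/eqP; rewrite -subr_eq0.
  have /eqP : (z ^+ m - 1) *: phi = 0 by rewrite scalerBl scale1r -phiE subrr.
  by rewrite scaler_eq0 (negPf phi_n0) orbF.
have alarc x y : e x y -> al y = zi * al x.
  move=> exy; have xyA : (x, y) \in arcs e by rewrite inE.
  have /rowP/(_ (enum_rank_in xyA (x, y))) := phi0.
  by rewrite !mxE /arc_of enum_rankK_in // => /eqP; rewrite subr_eq0 => /eqP.
have [q epq] : exists q, e p q.
  by have := deg_gt0 p => /card_gt0P[q]; exists q.
have alp0 : al p != 0 by rewrite mulf_neq0 ?invr_neq0.
rewrite addrC; apply: (@Aint_inv_root _ _ 2) => //; last by rewrite mulrC.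
apply: (mulIf alp0); rewrite mul1r expr2 -mulrA -(alarc _ _ epq) -(alarc q p) //.
by rewrite e_sym.
Qed.

(** The roots of this determinant are inverses of eigenvalues of 2 T, and its constant term is 1. So
    it is the product of the factors 1 - X / z over its roots z, with algebraic integers as
    coefficients; being rational, these are integers. *)
Lemma pminor_integral m : (0 < m)%N -> mxpow (grover e) m = 1%:M ->
  forall j, is_int (pminor e (fun x => 2 / (deg e x)%:R) setT)`_j.
Proof.
move=> m_gt0 Um; set a := fun x => _.
set D := pminor _ _ _.
pose N := \matrix_(i < #|T|, j < #|T|) entry e a (enum_val i) (enum_val j).
have DE : D = \det N.
  rewrite -sum_pterm_det /D /pminor; apply: eq_bigl => s.
  by apply/subsetP.
have evalE (z : algC) : (map_poly ratr D).[z] = \det (\matrix_(i < #|T|, j < #|T|)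
    (if i == j then 1
     else if e (enum_val i) (enum_val j) then - (ratr (a (enum_val i)) * z) else 0)).
  rewrite DE -det_map_mx -[LHS]/(horner_eval z _) -det_map_mx; congr (\det _).
  apply/matrixP => i j; rewrite !mxE /entry.
  rewrite (inj_eq enum_val_inj); case: (i == j); first by rewrite !rmorph1.
  case: ifP => _; last by rewrite !rmorph0.
  by rewrite /= /horner_eval rmorphN /= map_polyZ map_polyX hornerN hornerZ hornerX.
have D0 : (map_poly ratr D).[0] = 1 :> algC.
  rewrite evalE -[RHS](det1 _ #|T|); congr (\det _); apply/matrixP => i j.
  by rewrite !mxE mulr0 oppr0 if_same; case: eqP.
have root_Aint (z : algC) : z != 0 -> root (map_poly ratr D) z -> z^-1 \in Aint.
  move=> z0; rewrite rootE evalE => /det0P[v v0 vN].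
  have [i vi0] : exists i, v 0 i != 0.
    by apply/existsP; rewrite -negb_forall; apply: contra v0 => /forallP v0;
       apply/eqP/rowP => i; rewrite mxE; apply/eqP.
  apply: (@Aint_grover_eigenvalue m _ (fun x => v 0 (enum_rank x)) (enum_val i)) => //.
    by rewrite enum_valK.
  move=> y; apply: (mulfI z0); rewrite mulVKf //.
  move/rowP/(_ (enum_rank y)): vN; rewrite !mxE.
  rewrite (reindex (@enum_rank T)) /=; last exact/onW_bij/enum_rank_bij.
  rewrite (bigD1 y) //= !mxE eqxx mulr1 => /eqP; rewrite addr_eq0 => /eqP ->.
  rewrite -sumrN mulr_sumr [in RHS]big_mkcond [in LHS]big_mkcond; apply: eq_bigr => x _.
  rewrite !mxE !enum_rankK (inj_eq enum_rank_inj); case: eqVneq => [->|_] /=.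
    by rewrite e_irr.
  case: ifP => _; last by rewrite mulr0 oppr0.
  by rewrite mulrN opprK -/(a x); ring.
have [r rE] := closed_field_poly_normal (map_poly ratr D : {poly algC}).
set lc := lead_coef _ in rE.
have r0 z : z \in r -> z != 0.
  move=> zr; apply/eqP => z0; move/eqP: D0; rewrite rE hornerZ horner_prod z0 in zr *.
  by rewrite (big_rem _ zr) /= hornerXsubC subrr mul0r mulr0 eq_sym oner_eq0.
have DP : map_poly ratr D = \prod_(z <- r) (1 - z^-1 *: 'X).
  have lcE : lc * \prod_(z <- r) - z = 1.
    rewrite -[RHS]D0 rE hornerZ horner_prod; congr (_ * _).
    by apply: eq_bigr => z _; rewrite hornerXsubC sub0r.
  rewrite -[RHS]scale1r -lcE -scalerA -scaler_prod rE; congr (_ *: _).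
  apply: eq_big_seq => z /r0 z0.
  by rewrite scalerBr scalerA mulNr mulfV // scaleN1r opprK scaleNr addrC alg_polyC.
have DAint : map_poly ratr D \is a polyOver Aint.
  rewrite DP big_seq rpred_prod // => z zr.
  rewrite rpredB ?rpred1 // polyOverZ ?polyOverX ?root_Aint ?r0 //.
  rewrite /root rE hornerZ horner_prod (big_rem _ zr) /= hornerXsubC subrr.
  by rewrite mul0r mulr0.
move=> j; have /polyOverP/(_ j) := DAint; rewrite coef_map /= => DjA.
have /intrP[n /eqP] := Cint_rat_Aint (Crat_rat _) DjA.
by rewrite -[n%:~R]ratr_int fmorph_eq => /eqP ->; exists n.
Qed.

End Spectrum.

(** * Polynomials with integer coefficients and path factors *)

Lemma is_intE (x : rat) : is_int x <-> x \is a Num.int.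
Proof. by split=> [|/intrP//] [z ->]; apply: intr_int. Qed.

Notation int_poly := (polyOver Num.int_num_subdef).

(** A polynomial with constant term 1 is invertible among integral power series; the coefficients of
    [q] are solved for one after the other. *)
Lemma int_poly_cancel (p q : {poly rat}) :
  p`_0 = 1 -> p \is a int_poly -> p * q \is a int_poly -> q \is a int_poly.
Proof.
move=> p0 /polyOverP pI /polyOverP pqI; apply/polyOverP => n.
have [m] := ubnP n; elim: m n => // m IHm n; rewrite ltnS => le_nm.
have := pqI n; rewrite coefM big_ord_recl p0 mul1r subn0 => sI.
rewrite -[q`_n](addrK (\sum_(i < n) p`_(lift ord0 i) * q`_(n - lift ord0 i))).
rewrite rpredB // rpred_sum // => i _; rewrite rpredM // IHm //.
by rewrite lift0; case: i => i /= lt_i; lia.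
Qed.

Lemma int_poly_mulXn_cancel n (p : {poly rat}) :
  'X^n * p \is a int_poly -> p \is a int_poly.
Proof.
move=> /polyOverP pI; apply/polyOverP => j.
by have := pI (n + j)%N; rewrite coefXnM ltnNge leq_addr addKn.
Qed.

(** This is det (I - X A) for the adjacency matrix A of the path on [n] vertices, a reversed
    Chebyshev polynomial. *)
Fixpoint path_poly n : {poly rat} :=
  match n with
  | 0 => 1
  | n'.+1 => match n' with 0 => 1 | m.+1 => path_poly n' - 'X^2 * path_poly m end
  end.

Lemma path_polySS n : path_poly n.+2 = path_poly n.+1 - 'X^2 * path_poly n.
Proof. by []. Qed.

Lemma path_poly_int n : path_poly n \is a int_poly.
Proof.
elim/ltn_ind: n => -[|[|n]] IH; [by rewrite /= rpred1 | by rewrite /= rpred1 |].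
by rewrite path_polySS rpredB ?rpredM ?rpredX ?polyOverX ?IH // leqW.
Qed.

Lemma path_poly_coef0 n : (path_poly n)`_0 = 1.
Proof.
elim/ltn_ind: n => -[|[|n]] IH; [by rewrite /= coef1 | by rewrite /= coef1 |].
by rewrite path_polySS coefB coefXnM IH // subr0.
Qed.

Section Path.
Variables (T : finType) (e : rel T) (a : T -> rat).
Hypotheses (e_sym : symmetric e) (e_irr : irreflexive e).

Fixpoint add_path (R : {set T}) (p : nat -> T) m : {set T} :=
  if m is n.+1 then p n |: add_path R p n else R.

Lemma in_add_path (R : {set T}) (p : nat -> T) m x :
  reflect (x \in R \/ exists2 l, (l < m)%N & x = p l) (x \in add_path R p m).
Proof.
elim: m x => [|m IHm] x /=.
  by apply: (iffP idP) => [|[|[]]//]; left.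
rewrite in_setU1; apply: (iffP orP) => [[/eqP->|/IHm[xR|[l lm ->]]]|[xR|[l]]].
- by right; exists m.
- by left.
- by right; exists l => //; apply: leqW.
- by right; apply/IHm; left.
- rewrite ltnS leq_eqVlt => /orP[/eqP->->|lm ->]; first by left.
  by right; apply/IHm; right; exists l.
Qed.

(** The path is a component apart from [R]. Expanding at its last vertex gives the recursion of
    [path_poly], since all weights on it are 1. *)
Lemma pminor_add_path (R : {set T}) (p : nat -> T) m : swaps_only e (add_path R p m) ->
    (forall l, (l < m)%N -> p l \notin R) ->
    (forall l l', (l < l' < m)%N -> p l != p l') ->
    (forall l y, (l < m)%N -> y \in R -> ~~ e (p l) y) ->
    (forall l, (l.+1 < m)%N -> e (p l) (p l.+1)) ->
    (forall l l', (l.+1 < l' < m)%N -> ~~ e (p l') (p l)) ->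
    (forall l, (l < m)%N -> a (p l) = 1) ->
  pminor e a (add_path R p m) = path_poly m * pminor e a R.
Proof.
move=> + pR p_inj pRe pe pne pa.
have pout n : (n < m)%N -> p n \notin add_path R p n.
  move=> nm; apply/in_add_path => -[pnR|[l ln E]].
    by have := pR _ nm; rewrite pnR.
  by have := p_inj l n; rewrite ln nm E eqxx => /(_ isT).
suff main n : (n <= m)%N -> swaps_only e (add_path R p n) ->
    pminor e a (add_path R p n) = path_poly n * pminor e a R by exact: main.
elim/ltn_ind: n => -[|[|n]] IH lenm sV; first by rewrite mul1r.
  rewrite mul1r (pminor_vertex_swaps _ e_sym e_irr (setU11 _ _) sV) /=.
  rewrite setU1K ?pR // big1 ?addr0 // => y /andP[].
  rewrite in_setU1 => /orP[/eqP->|yR]; first by rewrite e_irr.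
  by rewrite (negPf (pRe _ _ lenm yR)).
rewrite (pminor_vertex_swaps _ e_sym e_irr (setU11 _ _) sV).
rewrite setU1K ?pout // (big_pred1 (p n)) => [|y]; last first.
  apply/andP/eqP => [[]|->]; last by rewrite !inE eqxx orbT e_sym pe.
  rewrite !in_setU1 => /or3P[/eqP->|/eqP-> //|]; first by rewrite e_irr.
  move=> /in_add_path[yR|[l ln ->]]; first by rewrite (negPf (pRe _ _ lenm yR)).
  by rewrite (negPf (pne l n.+1 _)) // ltnS ln lenm.
have sV1 : swaps_only e (add_path R p n.+1) by apply: swaps_onlyW sV; apply: subsetUr.
have sV0 : swaps_only e (add_path R p n) by apply: swaps_onlyW sV1; apply: subsetUr.
rewrite setU1K ?pout 1?ltnW // !pa ?(ltnW lenm) // mulr1 scaleN1r.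
rewrite (IH n.+1) ?(IH n) ?(ltnW lenm) //; last exact: ltnW (ltnW lenm).
by rewrite path_polySS mulrBl mulNr mulrA.
Qed.

End Path.

(** * The cycle *)

Lemma nbrs_eq (T : finType) (e : rel T) (x : T) (A : {set T}) :
  {in A, forall y, e x y} -> deg e x = #|A| -> forall y, e x y = (y \in A).
Proof.
move=> Ae dx y; have /eqP -> : A == [set y | e x y]; last by rewrite inE.
rewrite eqEcard cardsE -/(deg e x) dx leqnn andbT.
by apply/subsetP => z zA; rewrite inE Ae.
Qed.

(** * Matching sums as coefficients of principal minors *)

Section KgenCoef.
Variables (T : finType) (e : rel T).
Hypotheses (e_sym : symmetric e) (e_irr : irreflexive e).

(** The second hypothesis says that the edges inside [V] are those off [C] and outside [X]. Each
    matched edge xy has weight (2 / deg x) (2 / deg y), four times its [Mw]. *)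
Lemma coef_Kgen (C V : {set T}) (X : {set {set T}}) n : swaps_only e V ->
    (forall x y, e x y -> ([set x; y] \subset V) =
       [disjoint [set x; y] & C] && ([set x; y] \notin X)) ->
  (pminor e (fun x => 2 / (deg e x)%:R) V)`_(2 * n) = (-1) ^+ n * (4 ^+ n * Kgen e C X n).
Proof.
move=> sV VX; rewrite pminor_matching_poly // coef_matching_poly // mul2n odd_double doubleK.
congr (_ * _); rewrite mulr_sumr; apply: eq_big => [M|M /andP[MV /eqP <-]].
  rewrite andbC; congr (_ && (_ && _)); apply: eq_forallb => s.
  case: (s \in M) => //=; case: (boolP (is_edge e s)) => //=.
  by move=> /existsP[x /existsP[y /andP[exy /eqP->]]]; apply: VX.
rewrite -prodr_const -big_split /=; apply: eq_bigr => s sM.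
have /matching_onP[M1 _ _] := MV.
have /existsP[x /existsP[y /andP[exy /eqP->]]] := M1 s sM.
have nxy : x \notin [set y] by rewrite inE; apply: contraTneq exy => ->; rewrite e_irr.
rewrite /Mw !big_setU1 //= !big_set1 invfM.
by rewrite mulrACA -[4]/(2 * 2)%:R natrM.
Qed.

End KgenCoef.

(** * Expansion of the determinant around the vertex of degree 4 *)

Section OddUnicycle.
Variables (T : finType) (e : rel T) (k : nat) (c : 'I_k -> T) (u : T).
Variables (rho : T -> T) (d : T -> nat).
Hypotheses (e_sym : symmetric e) (e_irr : irreflexive e).
Hypotheses (odd_k : odd k) (k_ge3 : (3 <= k)%N) (c_inj : injective c).
Let C := [set c i | i : 'I_k].
Hypothesis rho_c : forall i, rho (c i) = c (ordS i).
Hypothesis rho_descends : forall x, x \notin C -> (d (rho x) < d x)%N.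
Hypothesis e_rho : forall x, e x (rho x).
Hypothesis rho_edge : forall x y, e x y -> y = rho x \/ x = rho y.
Hypothesis c_u : forall i : 'I_k, val i = 0%N -> c i = u.
Hypothesis deg_u : deg e u = 4%N.
Hypothesis deg_c : forall i : 'I_k, val i != 0%N -> deg e (c i) = 2%N.

Let a x : rat := 2 / (deg e x)%:R.
Local Notation D := (pminor e a).

Lemma k_gt0 : (0 < k)%N. Proof. exact: leq_trans k_ge3. Qed.

(** Indices are read modulo [k], so that successors need no case distinction and [cc k] is [u]
    again. *)
Let cc l := c (Ordinal (ltn_pmod l k_gt0)).

Lemma cc0 : cc 0 = u. Proof. by apply: c_u; rewrite /= mod0n. Qed.

Lemma ccC l : cc l \in C. Proof. by rewrite /C imset_f. Qed.

Lemma uC : u \in C. Proof. by rewrite -cc0 ccC. Qed.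

#[local] Hint Resolve ccC uC k_gt0 : core.

Lemma cc_mod l l' : cc l = cc l' -> l = l' %[mod k].
Proof. by move/c_inj/(congr1 val). Qed.

Lemma cc_neq l l' : (l < k)%N -> (l' < k)%N -> l != l' -> cc l != cc l'.
Proof.
by move=> lk l'k; apply: contra_neq => /cc_mod; rewrite !modn_small.
Qed.

Lemma inC x : x \in C -> exists2 l, (l < k)%N & x = cc l.
Proof.
move=> /imsetP[i _ ->]; exists (val i); [by case: i | congr c].
by apply: val_inj; rewrite /= modn_small ?(ltn_ord i).
Qed.

Lemma rho_cc l : rho (cc l) = cc l.+1.
Proof.
rewrite /cc rho_c; congr c; apply: val_inj => /=.
by rewrite -addn1 modnDml addn1.
Qed.

Lemma e_cc l : e (cc l) (cc l.+1). Proof. by rewrite -rho_cc. Qed.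

#[local] Hint Resolve e_cc : core.

Lemma cck : cc k = u. Proof. by rewrite -cc0; congr c; apply: val_inj; rewrite /= modnn mod0n. Qed.

Lemma deg_cc l : (0 < l < k)%N -> deg e (cc l) = 2%N.
Proof. by move=> /andP[l0 lk]; rewrite deg_c //= modn_small // -lt0n. Qed.

Lemma a_cc l : (0 < l < k)%N -> a (cc l) = 1.
Proof. by move=> /deg_cc dl; rewrite /a dl divff. Qed.

Lemma a_u : a u = 2^-1. Proof. by rewrite /a deg_u; field. Qed.

Lemma nbrs_cc l y : (l.+1 < k)%N -> e (cc l.+1) y = (y \in [set cc l; cc l.+2]).
Proof.
move=> lk; apply: nbrs_eq => [z|].
  by rewrite !inE => /orP[]/eqP ->; rewrite // e_sym.
rewrite deg_cc // cards2; case: eqVneq => // /cc_mod /eqP.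
by rewrite -addn2 -{1}[l]addn0 eqn_modDl mod0n modn_small.
Qed.

Lemma off_cycle_swaps (V : {set T}) : u \notin V -> swaps_only e V.
Proof.
apply: (swaps_only_off_cycle e_sym (C := C) _ rho_descends rho_edge) => //.
- exact: rho_cycle_closed.
- exact: rho_cycle_transitive.
- exact: (rho_cycle2_neq k_ge3 c_inj rho_c).
Qed.

(** The path consists of the cycle vertices with indices s + 1, ..., s + m; the bound stops it
    before [cc k = u]. The shift [s] allows it to start at index 1 or 2. *)
Lemma cycle_part (R : {set T}) s m : [disjoint R & C] -> (s.+1 + m <= k)%N ->
  D (add_path R (fun l => cc (l + s).+1) m) = path_poly m * D R.
Proof.
move=> /disjointFl RC smk.
have uP : u \notin add_path R (fun l => cc (l + s).+1) m.
  apply/in_add_path => -[|[l lm]]; first by rewrite RC.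
  by rewrite -cc0 => /cc_mod; rewrite mod0n modn_small; lia.
apply: pminor_add_path => //; first exact: off_cycle_swaps.
- by move=> l lm; rewrite RC.
- by move=> l l' lm; apply: cc_neq; lia.
- move=> l y lm yR; rewrite nbrs_cc; last by lia.
  by rewrite !inE; apply/norP; split; apply: contraTneq yR => ->; rewrite RC.
- move=> l l' lm; rewrite nbrs_cc ?inE; last by lia.
  apply/norP; split; first by apply: cc_neq; lia.
  have [->|nk] := eqVneq (l' + s).+2 k; last by apply: cc_neq; lia.
  by rewrite cck -cc0; apply: cc_neq; lia.
- by move=> l lm; apply: a_cc; lia.
Qed.

Let odd_zero (p : {poly rat}) := forall j, odd j -> p`_j = 0.

Lemma odd_zeroD p q : odd_zero p -> odd_zero q -> odd_zero (p + q).
Proof. by move=> hp hq j oj; rewrite coefD hp ?hq // addr0. Qed.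

Lemma odd_zeroX2 b p : odd_zero p -> odd_zero (b *: 'X^2 * p).
Proof.
move=> hp j oj; rewrite -scalerAl coefZ coefXnM; case: ltnP; rewrite ?mulr0 //.
by move=> j2; rewrite hp ?mulr0 // oddB // oj.
Qed.

Lemma odd_zeroM (V : {set T}) : u \notin V -> odd_zero (D V).
Proof. by move=> uV j oj; rewrite pminor_matching_poly ?coef_matching_poly ?oj //; apply: off_cycle_swaps. Qed.

Variables v1 w1 : T.
Hypotheses (e_uv : e u v1) (e_uw : e u w1) (vw_neq : v1 != w1).
Hypotheses (vC : v1 \notin C) (wC : w1 \notin C).

Lemma neq_off x y : x \in C -> y \notin C -> x != y.
Proof. by move=> xC; apply: contraNneq => <-. Qed.

Lemma nbrs_u y : e u y = (y \in cc 1 |: (cc k.-1 |: (v1 |: [set w1]))).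
Proof.
apply: nbrs_eq => [z|].
  rewrite !inE => /or4P[]/eqP -> //; first by rewrite -cc0.
  by rewrite e_sym -cck -{2}(prednK k_gt0).
rewrite deg_u !cardsU1 cards1 !inE !negb_or !(neq_off (ccC _) vC) !(neq_off (ccC _) wC).
by rewrite vw_neq cc_neq //; lia.
Qed.

Hypotheses (a_v : a v1 = 1) (a_w : a w1 = 1).

(** Only [u], of degree 4, has a weight other than 1. This half cancels the factor 2 from the two
    rotations, which leaves the coefficient -1 in [pminor_setT]. *)
Lemma prod_a_cycle : \prod_(x in C) a x = 2^-1.
Proof.
rewrite (bigD1 u) //= a_u big1 ?mulr1 // => x /andP[/inC[l lk ->] nu].
by apply: a_cc; rewrite lk andbT lt0n; apply: contraNneq nu => ->; rewrite cc0.
Qed.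

Lemma card_cycle : #|C| = k.
Proof. by rewrite card_imset // card_ord. Qed.

Lemma setT_u : setT :\ u = add_path (~: C) (fun l => cc (l + 0).+1) k.-1.
Proof.
apply/setP => x; rewrite !inE andbT; apply/idP/in_add_path => [nu|[|[l lk ->]]].
- have [/inC[[|l] lk xl]|xC] := boolP (x \in C); last by left; rewrite inE.
    by rewrite xl cc0 eqxx in nu.
  by right; exists l; rewrite ?addn0 // -ltnS prednK.
- by rewrite inE; apply: contraNneq => ->.
- by rewrite -cc0 cc_neq //; lia.
Qed.

Lemma setT_u_nbr y : y \notin C ->
  setT :\ u :\ y = add_path (~: C :\ y) (fun l => cc (l + 0).+1) k.-1.
Proof.
move=> yC; rewrite setT_u; apply/setP => x; rewrite !inE.
apply/andP/in_add_path => [[ny /in_add_path[xC|xl]]|[|[l lk ->]]].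
- by left; rewrite !inE ny -in_setC.
- by right.
- by rewrite !inE => /andP[-> xC]; split=> //; apply/in_add_path; left; rewrite inE.
- rewrite neq_off //; split=> //; apply/in_add_path; right; by exists l.
Qed.

Lemma setT_u_first :
  setT :\ u :\ cc 1 = add_path (~: C) (fun l => cc (l + 1).+1) k.-2.
Proof.
rewrite setT_u; apply/setP => x; rewrite !inE.
apply/andP/in_add_path => [[n1 /in_add_path[xC|[l lk xl]]]|[xC|[l lk ->]]].
- by left.
- right; case: l => [|l] in lk xl; first by rewrite xl eqxx in n1.
  by exists l; rewrite ?addn1 ?xl ?addn0 //; lia.
- by rewrite eq_sym neq_off -?in_setC //; split=> //; apply/in_add_path; left.
- rewrite cc_neq; try lia; split=> //; apply/in_add_path; right.
  by exists l.+1; rewrite ?addn1 ?addn0 //; lia.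
Qed.

Lemma setT_u_last :
  setT :\ u :\ cc k.-1 = add_path (~: C) (fun l => cc (l + 0).+1) k.-2.
Proof.
have [m km] : exists m, k = m.+2 by exists (k - 2)%N; lia.
have [E2 E1] : k.-2 = m /\ k.-1 = m.+1 by lia.
rewrite setT_u E2 E1 /= addn0 setU1K //; apply/in_add_path => -[|[l lm]]; first by rewrite inE ccC.
by move/eqP; apply/negP; apply: cc_neq; lia.
Qed.

(** The contribution of the permutations that fix [u] or swap it with a neighbour. *)
Definition even_part : {poly rat} := D (setT :\ u) +
  \sum_(y | e u y) - (a u * a y) *: 'X^2 * D (setT :\ u :\ y).

Lemma pminor_setT : D setT = even_part - 'X^k * D (~: C).
Proof.
have [r [rC even_r rE]] := exists_rotation c_inj rho_c odd_k.
have eC x : x \in C -> e x (rho x) by [].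
rewrite (pminor_cycle a e_sym e_irr (rho_cycle_closed rho_c) rho_descends rho_edge
  (rho_cycle_transitive rho_c) (rho_cycle2_neq k_ge3 c_inj rho_c) uC rC even_r rE eC).
congr (_ + _); rewrite card_cycle prod_a_cycle -signr_odd odd_k -scaler_nat scalerA.
by rewrite (_ : _ * _ = -1) ?scaleN1r ?mulNr //; field.
Qed.

Lemma coef_even_part : odd_zero even_part.
Proof.
apply: odd_zeroD; first by apply: odd_zeroM; rewrite !inE eqxx.
move=> j oj; rewrite coef_sum big1 // => y _.
by rewrite odd_zeroX2 //; apply: odd_zeroM; rewrite !inE eqxx andbF.
Qed.

Lemma even_partE : even_part =
  path_poly k.-1 * D (~: C) - 'X^2 * path_poly k.-2 * D (~: C)
  - path_poly k.-1 * ('X^2 * (2^-1 *: (D (~: C :\ v1) + D (~: C :\ w1)))).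
Proof.
have CC : [disjoint ~: C & C] by rewrite -setI_eq0 setIC setICr.
have CCy y : [disjoint ~: C :\ y & C] by apply: disjointWl (subD1set _ _) CC.
rewrite /even_part (eq_bigl (mem (cc 1 |: (cc k.-1 |: (v1 |: [set w1]))))); last first.
  by move=> y; rewrite nbrs_u.
have n1 : cc 1 \notin cc k.-1 |: (v1 |: [set w1]).
  by rewrite !inE !negb_or !(neq_off (ccC _) vC) !(neq_off (ccC _) wC) cc_neq //; lia.
have n2 : cc k.-1 \notin v1 |: [set w1].
  by rewrite !inE !negb_or !(neq_off (ccC _) vC) !(neq_off (ccC _) wC).
have n3 : v1 \notin [set w1] by rewrite inE.
rewrite !big_setU1 // big_set1 setT_u_first setT_u_last !setT_u_nbr // setT_u.
rewrite !cycle_part //; try lia.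
rewrite a_v a_w !a_cc ?a_u; try lia.
rewrite mulr1.
set p := path_poly k.-1; set q := path_poly k.-2; set F := D (~: C).
rewrite !scaleNr -!mul_polyC.
(* Each of the two neighbours of [u] on the cycle contributes one half of this term. It is split
   beforehand, because 1/2 becomes an opaque constant for [ring]. *)
have -> : 'X^2 * q * F = (2^-1)%:P * ('X^2 * (q * F)) + (2^-1)%:P * ('X^2 * (q * F)).
  by rewrite -mulrDl -polyCD -mulrA (_ : 2^-1 + 2^-1 = 1 :> rat) ?mul1r //; field.
by move: (2^-1)%:P => h /=; ring.
Qed.

Hypothesis int_D : D setT \is a int_poly.

(** For even j the index k + j is odd, so the even part vanishes there and the coefficient of
    [D setT] is minus the coefficient j of [D (~: C)]. Odd coefficients of the latter vanish. *)
Lemma int_off_cycle : D (~: C) \is a int_poly.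
Proof.
have [oF uF] : odd_zero (D (~: C)) /\ u \notin ~: C.
  by split; [apply: odd_zeroM|]; rewrite inE uC.
apply/polyOverP => j; have [oj|ej] := boolP (odd j); first by rewrite oF // rpred0.
move/polyOverP/(_ (k + j)%N): int_D; rewrite pminor_setT coefB coefXnM ltnNge leq_addr.
by rewrite addKn coef_even_part ?sub0r ?rpredN // oddD odd_k /= ej.
Qed.

(** In [even_partE] all other terms are integral, and the factors [path_poly k.-1] and X^2 can be
    cancelled. *)
Lemma int_half_sum : 2^-1 *: (D (~: C :\ v1) + D (~: C :\ w1)) \is a int_poly.
Proof.
apply: (@int_poly_mulXn_cancel 2).
apply: (int_poly_cancel (path_poly_coef0 k.-1) (path_poly_int _)).
have -> : path_poly k.-1 * ('X^2 * (2^-1 *: (D (~: C :\ v1) + D (~: C :\ w1)))) =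
  path_poly k.-1 * D (~: C) - 'X^2 * path_poly k.-2 * D (~: C) - 'X^k * D (~: C) - D setT.
  by rewrite pminor_setT even_partE; ring.
by rewrite !(rpredB, rpredM) ?rpredX ?polyOverX ?path_poly_int ?int_off_cycle //.
Qed.

End OddUnicycle.

(** * The two branches *)

Section Branch.
Variables (T : finType) (e : rel T) (C : {set T}) (u : T).
Variables (rho : T -> T) (d : T -> nat) (v : nat -> T) (t : nat).
Hypotheses (e_sym : symmetric e) (e_irr : irreflexive e).
Hypothesis uC : u \in C.
Hypothesis rho_closed : forall x, x \in C -> rho x \in C.
Hypothesis rho_descends : forall x, x \notin C -> (d (rho x) < d x)%N.
Hypothesis rho_edge : forall x y, e x y -> y = rho x \/ x = rho y.
Hypothesis off_swaps : forall V : {set T}, u \notin V -> swaps_only e V.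
Hypotheses (v0 : v 0%N = u) (e_v1 : e u (v 1%N)) (v1C : v 1%N \notin C).
Hypothesis v_deg : forall j, (j < t)%N -> deg e (v j.+1) = 2%N.
Hypothesis v_next : forall j, (j < t)%N -> e (v j.+1) (v j.+2) /\ v j.+2 != v j.

Let a x : rat := 2 / (deg e x)%:R.
Local Notation D := (pminor e a).

(** A branch leads away from the cycle: the next vertex differs from the parent [v j] of [v j.+1],
    so the edge to it must come from [rho] at its far end. *)
Lemma branch_parent j : (j <= t)%N -> v j.+1 \notin C /\ rho (v j.+1) = v j.
Proof.
elim: j => [_|j IHj lt_jt].
  split=> //; rewrite v0; case: (rho_edge e_v1) => [v1E|//].
  by case/negP: v1C; rewrite v1E rho_closed.
have [nC par] := IHj (ltnW lt_jt); have [ev /eqP nv] := v_next lt_jt.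
case: (rho_edge ev) => [|E]; first by rewrite par.
by split=> //; apply: contra nC => vC; rewrite E rho_closed.
Qed.

Lemma branch_neq l l' : (l < l' <= t)%N -> v l.+1 != v l'.+1.
Proof.
suff lt_d : (l < l' <= t)%N -> (d (v l.+1) < d (v l'.+1))%N.
  by move=> /lt_d; apply: contraTneq => ->; rewrite ltnn.
elim: l' => // l' IH; rewrite ltnS => /andP[le_l lt_l'].
have [nC E] := branch_parent lt_l'.
have lt1 : (d (v l'.+1) < d (v l'.+2))%N by rewrite -E rho_descends.
move: le_l; rewrite leq_eqVlt => /orP[/eqP-> //|lt_l].
by apply: ltn_trans lt1; rewrite IH // lt_l ltnW.
Qed.

Lemma nbrs_branch l y : (l < t)%N -> e (v l.+1) y = (y \in [set v l; v l.+2]).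
Proof.
move=> lt_l; have [ev nv] := v_next lt_l; apply: nbrs_eq => [z|].
  rewrite !inE => /orP[]/eqP -> //.
  case: l => [|l] in lt_l ev nv *; first by rewrite v0 e_sym.
  by have [] := v_next (ltnW lt_l); rewrite e_sym.
by rewrite v_deg // cards2 eq_sym nv.
Qed.

Fixpoint branch_off n : {set T} :=
  if n is m.+1 then branch_off m :\ v n else ~: C.

Lemma in_branch_off n x : reflect (x \notin C /\ forall l, (l < n)%N -> x != v l.+1)
  (x \in branch_off n).
Proof.
elim: n => [|n IHn] /=.
  by rewrite inE; apply: (iffP idP) => [xC|[]//]; split.
rewrite in_setD1; apply: (iffP andP) => [[nx /IHn[xC xv]]|[xC xv]].
  split=> // l; rewrite ltnS leq_eqVlt => /orP[/eqP-> //|]; exact: xv.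
by split; [exact: xv | apply/IHn; split=> // l ln; apply/xv/ltnW].
Qed.

Lemma branch_off_swaps n : swaps_only e (branch_off n).
Proof. by apply: off_swaps; apply/in_branch_off => -[]; rewrite uC. Qed.

(** The minor is expanded at [v n.+1], whose only neighbour left in the set is [v n.+2]; both have
    weight 1. *)
Lemma pminor_branch_off n : (n.+1 < t)%N ->
  D (branch_off n) = D (branch_off n.+1) - 'X^2 * D (branch_off n.+2).
Proof.
move=> lt_n; have lt_n' := ltnW lt_n.
have av l : (l < t)%N -> a (v l.+1) = 1 by move=> lt_l; rewrite /a v_deg // divff.
have vin : v n.+1 \in branch_off n.
  apply/in_branch_off; split; first by case: (branch_parent (ltnW lt_n')).
  by move=> l ln; rewrite eq_sym branch_neq // ln ltnW.
rewrite (pminor_vertex_swaps _ e_sym e_irr vin (@branch_off_swaps n)).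
rewrite (big_pred1 (v n.+2)) => [|y]; last first.
  rewrite nbrs_branch // !inE; apply/andP/eqP => [[yV /orP[]/eqP yE //]|->]; last first.
    rewrite eqxx orbT; split=> //; apply/in_branch_off; split.
      by case: (branch_parent lt_n').
    by move=> l ln; rewrite eq_sym branch_neq // lt_n' ltnS ltnW.
  move: yV; rewrite yE; case: (n) => [|m] /in_branch_off[vC vl].
    by rewrite v0 uC in vC.
  by have := vl m (ltnSn m); rewrite eqxx.
by rewrite !av // mulr1 scaleN1r mulNr.
Qed.

(** Deleting v_1, ..., v_n removes the edges g_2, ..., g_{n+1}, hence the shift to [n.+1]. The edge
    g_1 meets the cycle and is already excluded. *)
Lemma coef_branch_off n m : (n <= t)%N -> (D (branch_off n))`_(2 * m)
  = (-1) ^+ m * (4 ^+ m * Kgen e C (pathedges v n.+1) m).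
Proof.
move=> le_n; apply: coef_Kgen => // [|x y exy]; first exact: branch_off_swaps.
apply/subsetP/andP => [sub|[dis out] z zs].
  split.
    rewrite -setI_eq0; apply/eqP/setP => z; rewrite in_setI in_set0.
    by apply/negP => /andP[/sub/in_branch_off[/negP]].
  apply/imsetP => -[l]; rewrite inE => l2 sE.
  have : v (val l).-1 \in [set x; y] by rewrite sE set21.
  move=> /sub/in_branch_off[_ /(_ (val l).-2)].
  case: l l2 {sE} => -[|[|l]] //= lt_l _ /(_ _)/eqP; apply => //.
have zC : z \notin C by rewrite (disjointFr dis).
apply/in_branch_off; split=> // l ln; apply: contraNneq out => zE.
have lt_l := leq_trans ln le_n.
have [z' ez' sE] : exists2 z', e z z' & [set x; y] = [set z; z'].
  move: zs; rewrite !inE => /orP[]/eqP->; first by exists y.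
  by exists x; rewrite 1?setUC // e_sym.
(* An edge at a deleted vertex goes on to the next branch vertex or back to the previous one; at v_1
   the latter is [u], on the cycle. *)
rewrite sE; move: ez'; rewrite zE nbrs_branch // !inE => /orP[]/eqP z'E; last first.
  apply/imsetP; exists (@Ordinal n.+2 l.+2 ln); rewrite ?inE //= z'E.
  by [].
case: l => [|l] in zE z'E ln lt_l *.
  have : z' \in [set x; y] by rewrite sE set22.
  by move=> /(disjointFr dis); rewrite z'E v0 uC.
apply/imsetP; exists (@Ordinal n.+2 l.+2 (leqW ln)); rewrite ?inE //= z'E.
by rewrite setUC.
Qed.

End Branch.

Unset Implicit Arguments.

Theorem theorem3p7 (T : finType) (e : rel T) (k : nat) (c : 'I_k -> T)
    (u : T) (v w : nat -> T) (t : nat) :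
  (* G is a simple connected graph with |V| = |E|, non-bipartite *)
  simple_graph e -> connected_graph e -> #|arcs e| = (2 * #|T|)%N ->
  ~ bipartite e ->
  (* its unique cycle u = c 0, c 1 = u_1, ..., c (k-1) = u_{k-1}, of odd length k >= 3 *)
  odd k -> (3 <= k)%N -> injective c ->
  (forall i : 'I_k, val i = 0%N -> c i = u) ->
  (forall i j : 'I_k, val j = ((val i).+1 %% k)%N -> e (c i) (c j)) ->
  deg e u = 4%N ->
  (forall i : 'I_k, val i != 0%N -> deg e (c i) = 2%N) ->
  (* Grover walk periodic with odd period *)
  odd_period_grover e ->
  (* v_1, w_1: the two neighbours of u off the cycle *)
  e u (v 1%N) -> e u (w 1%N) -> v 1%N != w 1%N ->
  v 1%N \notin [set c i | i : 'I_k] -> w 1%N \notin [set c i | i : 'I_k] ->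
  v 0%N = u -> w 0%N = u ->
  (1 <= t)%N ->
  (forall j : nat, (1 <= j <= t)%N -> deg e (v j) = 2%N /\ deg e (w j) = 2%N) ->
  (* v_j (resp. w_j) is the neighbour of v_{j-1} other than v_{j-2} *)
  (forall j : nat, (2 <= j <= t.+1)%N ->
     [/\ e (v j.-1) (v j), v j != v (j - 2)%N,
         e (w j.-1) (w j) & w j != w (j - 2)%N]) ->
  let cyc := [set c i | i : 'I_k] in
  forall i : nat, (1 <= i <= t)%N ->
    [/\ is_int ((2 : rat) ^+ (2 * i) * Kgen e cyc set0 i),
        is_int ((2 : rat) ^ (2 * ((i : int) - 1) - 1) *
                Lsum e cyc v w i.-1 2) &
        forall j : nat, (2 <= j <= i.-1)%N ->
          is_int ((2 : rat) ^ (2 * ((i : int) - (j : int)) - 1) *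
                  Lsum e cyc v w (i - j)%N j.+1)].
Proof.
move=> [e_sym e_irr] conn arcsE _ odd_k k3 c_inj c_u c_e deg_u deg_c [m [m0 _ Um _]].
move=> e_uv e_uw vw vC wC v0 w0 _ deg_vw step cyc i /andP[i1 it].
have c_edge j : e (c j) (c (ordS j)) by apply: c_e.
have [rho [d [rho_c rho_d e_rho rho_e]]] :=
  unicyclic_functional e_sym conn arcsE k3 c_inj c_edge.
have deg_gt0 x : (0 < deg e x)%N by apply/card_gt0P; exists (rho x); apply: e_rho.
pose a x : rat := 2 / (deg e x)%:R.
have int_D : pminor e a setT \is a int_poly.
  by apply/polyOverP => j; apply/is_intE/(pminor_integral e_sym e_irr deg_gt0 m0 Um).
have off_swaps (V : {set T}) : u \notin V -> swaps_only e V.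
  exact: (off_cycle_swaps e_sym k3 c_inj rho_c rho_d rho_e c_u).
have uC : u \in cyc.
  by rewrite -(c_u (Ordinal (leq_trans (isT : (0 < 3)%N) k3))) // imset_f.
have v_deg j : (j < t)%N -> deg e (v j.+1) = 2%N by move=> jt; case: (deg_vw j.+1).
have w_deg j : (j < t)%N -> deg e (w j.+1) = 2%N by move=> jt; case: (deg_vw j.+1).
have v_next j : (j < t)%N -> e (v j.+1) (v j.+2) /\ v j.+2 != v j.
  by move=> jt; have [] := step j.+2 jt; rewrite subSS subSS subn0.
have w_next j : (j < t)%N -> e (w j.+1) (w j.+2) /\ w j.+2 != w j.
  by move=> jt; have [] := step j.+2 jt; rewrite subSS subSS subn0.
have rhoC x : x \in cyc -> rho x \in cyc by apply: rho_cycle_closed.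
have int_off : pminor e a (~: cyc) \is a int_poly.
  exact: (int_off_cycle e_sym e_irr odd_k k3 c_inj rho_c rho_d e_rho rho_e c_u deg_u
    deg_c int_D).
have t_gt0 : (0 < t)%N := leq_trans i1 it.
have a2 x : deg e x = 2%N -> a x = 1 by move=> dx; rewrite /a dx divff.
pose half n := 2^-1 *: (pminor e a (branch_off cyc v n) + pminor e a (branch_off cyc w n)).
(* For n = 0 both minors are that of the complement of the cycle, n = 1 is [int_half_sum], and the
   sum of the two branch recursions yields [half n.+2] up to the factor X^2. *)
have int_half n : (n <= t)%N -> half n \is a int_poly.
  elim/ltn_ind: n => -[|[|n]] IHn le_nt.
  - by rewrite /half -mulr2n -scaler_nat scalerA mulVf // scale1r.
  - apply: (int_half_sum e_sym e_irr odd_k k3 c_inj rho_c rho_d e_rho rho_e c_u deg_u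
      deg_c e_uv e_uw vw vC wC _ _ int_D); apply: a2; [exact: v_deg | exact: w_deg].
  - apply: (@int_poly_mulXn_cancel 2).
    have -> : 'X^2 * half n.+2 = half n.+1 - half n.
      rewrite /half (pminor_branch_off e_sym e_irr uC rhoC rho_d rho_e off_swaps
        v0 e_uv vC v_deg v_next le_nt).
      rewrite (pminor_branch_off e_sym e_irr uC rhoC rho_d rho_e off_swaps
        w0 e_uw wC w_deg w_next le_nt).
      by rewrite -!mul_polyC; ring.
    by rewrite rpredB // IHn // ltnW // ltnW.
have sign_int n (x : rat) : ((-1) ^+ n * x \is a Num.int) = (x \is a Num.int).
  exact: rpredMsign.
have int_L n (s : nat) : (n <= t)%N ->
    is_int ((2 : rat) ^ (2 * (s : int) - 1) * Lsum e cyc v w s n.+1).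
  move=> le_nt; apply/is_intE.
  have : (half n)`_(2 * s) \is a Num.int by move: (2 * s)%N; apply/polyOverP/int_half.
  rewrite coefZ coefD (coef_branch_off e_sym e_irr uC off_swaps v0 e_uv v_deg v_next) //.
  rewrite (coef_branch_off e_sym e_irr uC off_swaps w0 e_uw w_deg w_next) //.
  rewrite -!mulrDr mulrCA sign_int mulrA.
  have -> // : (2 : rat) ^ (2 * (s : int) - 1) = 2^-1 * 4 ^+ s.
  by rewrite expfzDr // -PoszM -exprnP exprM mulrC.
split.
- apply/is_intE.
  have : (pminor e a (~: cyc))`_(2 * i) \is a Num.int by move: (2 * i)%N; apply/polyOverP.
  rewrite (coef_Kgen e_sym e_irr (C := cyc) (X := set0)).
  + by rewrite exprM -[4]/(2 * 2)%:R natrM sign_int.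
  + by apply: off_swaps; rewrite inE uC.
  + by move=> x y _; rewrite disjoints_subset in_set0 andbT.
- have -> : (i : int) - 1 = i.-1 by lia.
  by apply: int_L; exact: leq_trans i1 it.
- move=> j /andP[j2 ji]; rewrite subzn; last by lia.
  by apply: int_L; lia.
Qed.
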